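(* Let $M$ be a manifold and let $(\varphi_a,\xi_a,\eta^a,g)$, $a\in\{1,2,3\}$, be a mixed metric 3-contact structure on $M$. Then $(\varphi_a,\xi_a,\eta^a,g)$ is a mixed 3-Sasakian structure.
   Context: All manifolds and tensor fields are smooth. A metric tensor is a symmetric non-degenerate $(0,2)$-tensor field (semi-Riemannian). Conventions: for a 1-form, $2d\eta(X,Y)=X(\eta(Y))-Y(\eta(X))-\eta([X,Y])$; the Nijenhuis tensor of a $(1,1)$-tensor field $\varphi$ is $N_\varphi(X,Y)=\varphi^2[X,Y]+[\varphi X,\varphi Y]-\varphi[\varphi X,Y]-\varphi[X,\varphi Y]$. A triple $(\varphi,\xi,\eta)$ of a $(1,1)$-tensor field, a vector field and a 1-form is an almost paracontact structure if $\varphi^2=I-\eta\otimes\xi$, $\eta(\xi)=1$, and an almost contact structure if $\varphi^2=-I+\eta\otimes\xi$, $\eta(\xi)=1$. It is normal if $N_\varphi=2d\eta\otimes\xi$ in the paracontact case, and if $N_\varphi=-2d\eta\otimes\xi$ in the contact case. Put $\tau_1=\tau_2=-1$, $\tau_3=+1$. A mixed 3-structure on $M$ is a triple of structures $(\varphi_a,\xi_a,\eta^a)$, $a\in\{1,2,3\}$, almost paracontact for $a=1,2$ and almost contact for $a=3$, such that for any cyclic permutation $(a,b,c)$ of $(1,2,3)$: $\varphi_a\varphi_b-\tau_a\eta^b\otimes\xi_a=\tau_c\varphi_c=-\varphi_b\varphi_a+\tau_b\eta^a\otimes\xi_b$; $\eta^a\circ\varphi_b=\tau_c\eta^c=-\eta^b\circ\varphi_a$;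 $\varphi_a(\xi_b)=\tau_b\xi_c$, $\varphi_b(\xi_a)=-\tau_a\xi_c$. If $g$ is a metric tensor on $M$ with $g(\varphi_aX,\varphi_aY)=\tau_a(g(X,Y)-\varepsilon_a\eta^a(X)\eta^a(Y))$ for all $a$ and all $X,Y\in\Gamma(TM)$, where $\varepsilon_a=g(\xi_a,\xi_a)=\pm1$, then $(\varphi_a,\xi_a,\eta^a,g)$ is a mixed metric 3-structure. Let $\Phi_a(X,Y):=g(X,\varphi_aY)$. A mixed metric 3-structure is a mixed metric 3-contact structure if $d\eta^a=\Phi_a$ for each $a\in\{1,2,3\}$. It is a mixed 3-Sasakian structure if $(\varphi_1,\xi_1,\eta^1,g)$ and $(\varphi_2,\xi_2,\eta^2,g)$ are paraSasakian and $(\varphi_3,\xi_3,\eta^3,g)$ is indefinite Sasakian, i.e. for each $a$ one has $d\eta^a=\Phi_a$ and the structure $(\varphi_a,\xi_a,\eta^a)$ is normal. Equivalently, with $\nabla$ the Levi-Civita connection of $g$, $(\nabla_X\varphi_a)(Y)=\tau_a(g(X,Y)\xi_a-\varepsilon_a\eta^a(Y)X)$ for all $X,Y$ and all $a\in\{1,2,3\}$. *)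

(* Defs.v *)
From HB Require Import structures.
From mathcomp Require Import all_boot all_order all_algebra.
From mathcomp Require Import all_classical all_reals all_analysis.
From mathcomp Require Import ring.

Set Implicit Arguments.
Unset Strict Implicit.
Unset Printing Implicit Defensive.

Import Order.TTheory GRing.Theory Num.Theory.
Import numFieldNormedType.Exports.

Local Open Scope classical_set_scope.
Local Open Scope ring_scope.

Section SmoothOn.
Variables (R : realType) (n : nat).
Implicit Types (U : set 'rV[R]_n) (f g : 'rV[R]_n -> R).

Definition partial (i : 'I_n) f : 'rV[R]_n -> R :=
  fun x => 'D_(delta_mx 0 i) f x.

(* Only meaningful for U open: continuity and derivability at the points of U
   are those of f on a full neighborhood. *)
Fixpoint Ck_on (k : nat) U f : Prop :=
  (forall x, U x -> {for x, continuous f}) /\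
  (if k is k'.+1 then
     forall i, (forall x, U x -> derivable f x (delta_mx 0 i)) /\
               Ck_on k' U (partial i f)
   else True).

Definition smooth_on U f : Prop := forall k, Ck_on k U f.

Lemma Ck_on_ext k U f g : open U -> (forall x, U x -> f x = g x) ->
  Ck_on k U f -> Ck_on k U g.
Proof.
move=> oU; elim: k f g => [|k IH] f g fg /= [cf df].
all: have nfg x : U x -> \near x, f x = g x
  by move=> Ux; near=> y; apply: fg; near: y; exact: open_nbhs_nbhs.
all: have cg x : U x -> {for x, continuous g}
  by move=> Ux; have /near_eq_cvg/cvg_trans := nfg x Ux;
     rewrite /prop_for /continuous_at -fg//; apply; exact: cf.
  by split.
split=> // i; have [dfi Cfi] := df i; split=> [x Ux|].
  by apply: (near_eq_derivable _ (dfi x Ux)); exact: nfg.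
by apply: IH Cfi => x Ux; apply: near_eq_derive; exact: nfg.
Unshelve. all: by end_near. Qed.

Lemma Ck_onW k U f : Ck_on k.+1 U f -> Ck_on k U f.
Proof.
elim: k f => [|k IH] f [cf df]; first by split.
by split=> // i; have [? /IH] := df i.
Qed.

Lemma Ck_on_cst k U (a : R) : open U -> Ck_on k U (cst a).
Proof.
move=> oU; elim: k a => [|k IH] a; split=> //; try by move=> x _; exact: cst_continuous.
move=> i; split=> [x _|]; first exact: derivable_cst.
apply: (@Ck_on_ext k U (cst 0)) => // x _.
by rewrite /partial derive_cst.
Qed.

Lemma Ck_onD k U f g : open U -> Ck_on k U f -> Ck_on k U g ->
  Ck_on k U (f \+ g).
Proof.
move=> oU; elim: k f g => [|k IH] f g [cf df] [cg dg].
  by split=> // x Ux; apply: continuousD; [exact: cf|exact: cg].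
split; first by move=> x Ux; apply: continuousD; [exact: cf|exact: cg].
move=> i; have [dfi Cfi] := df i; have [dgi Cgi] := dg i; split=> [x Ux|].
  by apply: derivableD; [exact: dfi|exact: dgi].
apply: (Ck_on_ext oU _ (IH _ _ Cfi Cgi)) => x Ux.
by rewrite /partial deriveD//; [exact: dfi|exact: dgi].
Qed.

Lemma Ck_onM k U f g : open U -> Ck_on k U f -> Ck_on k U g ->
  Ck_on k U (f \* g).
Proof.
move=> oU; elim: k f g => [|k IH] f g Cf Cg.
  case: Cf Cg => [cf _] [cg _]; split=> // x Ux.
  by apply: continuousM; [exact: cf|exact: cg].
have [Cf' Cg'] := (Ck_onW Cf, Ck_onW Cg).
case: Cf Cg => [cf df] [cg dg].
split; first by move=> x Ux; apply: continuousM; [exact: cf|exact: cg].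
move=> i; have [dfi Cfi] := df i; have [dgi Cgi] := dg i; split=> [x Ux|].
  by apply: derivableM; [exact: dfi|exact: dgi].
apply: (Ck_on_ext oU _ (Ck_onD oU (IH _ _ Cf' Cgi) (IH _ _ Cg' Cfi))) => x Ux.
by rewrite /partial deriveM//; [exact: dfi|exact: dgi].
Qed.

End SmoothOn.

Section Manifold.
Variables (R : realType) (n : nat).

Record chart (M : topologicalType) := Chart {
  dom : set M;
  cod : set 'rV[R]_n;
  coord : M -> 'rV[R]_n;
  param : 'rV[R]_n -> M;
  dom_open : open dom;
  cod_open : open cod;
  coord_cod : forall p, dom p -> cod (coord p);
  param_dom : forall x, cod x -> dom (param x);
  coordK : forall p, dom p -> param (coord p) = p;
  paramK : forall x, cod x -> coord (param x) = x;
  coord_continuous : forall p, dom p -> {for p, continuous coord};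
  param_continuous : forall x, cod x -> {for x, continuous param} }.

Definition compatible (M : topologicalType) (c d : chart M) : Prop :=
  forall j : 'I_n,
    smooth_on (cod c `&` param c @^-1` dom d) (fun x => coord d (param c x) 0 j).

Record manifold := Manifold {
  carrier :> topologicalType;
  carrier_hausdorff : hausdorff_space carrier;
  carrier_second_countable : @second_countable carrier;
  atlas : set (chart carrier);
  atlas_cover : forall p, exists2 c, atlas c & dom c p;
  atlas_compatible : forall c d, atlas c -> atlas d -> compatible c d }.

End Manifold.

Section SmoothFunctions.
Variables (R : realType) (n : nat) (M : manifold R n).

Definition is_smooth (f : M -> R) : Prop :=
  forall c, atlas c -> smooth_on (cod c) (f \o param c).

Definition smooth : {pred M -> R} := fun f => `[< is_smooth f >].

Fact smooth_cst (a : R) : cst a \in smooth.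
Proof.
by apply/asboolP => c _ k; exact: (Ck_on_cst _ _ (@cod_open _ _ _ c)).
Qed.

Fact smoothD (f g : M -> R) :
  f \in smooth -> g \in smooth -> f + g \in smooth.
Proof.
move=> /asboolP sf /asboolP sg; apply/asboolP => c ac k.
exact: (Ck_onD (@cod_open _ _ _ c) (sf c ac k) (sg c ac k)).
Qed.

Fact smoothM (f g : M -> R) :
  f \in smooth -> g \in smooth -> f * g \in smooth.
Proof.
move=> /asboolP sf /asboolP sg; apply/asboolP => c ac k.
exact: (Ck_onM (@cod_open _ _ _ c) (sf c ac k) (sg c ac k)).
Qed.

Fact smoothZ (a : R) (f : M -> R) : f \in smooth -> a *: f \in smooth.
Proof.
move=> sf; have -> : a *: f = cst a * f by [].
exact: smoothM (smooth_cst a) sf.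
Qed.

Fact smooth_subring : GRing.subring_closed smooth.
Proof.
split=> [|f g sf sg|]; [exact: smooth_cst| |exact: smoothM].
by rewrite -scaleN1r; apply: smoothD => //; exact: smoothZ.
Qed.

Fact smooth_scale : GRing.scaler_closed smooth.
Proof. by move=> a f; exact: smoothZ. Qed.

HB.instance Definition _ := GRing.isSubringClosed.Build _ smooth smooth_subring.
HB.instance Definition _ := GRing.isScaleClosed.Build _ _ smooth smooth_scale.

Record smooth_fun := SmoothFun {
  smooth_val :> M -> R;
  smooth_valP : smooth_val \in smooth }.

HB.instance Definition _ := [isSub for smooth_val].
HB.instance Definition _ := [Choice of smooth_fun by <:].
HB.instance Definition _ :=
  GRing.SubChoice_isSubComPzRing.Build _ _ smooth_fun smooth_subring.
HB.instance Definition _ := 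
  [SubZmodule_isSubLmodule of smooth_fun by <:].

End SmoothFunctions.

Arguments smooth {R n} M f.

Section VectorFields.
Variables (R : realType) (n : nat) (M : manifold R n).
Local Notation C := (smooth_fun M).

(* Tangent vectors at p are the derivations at p of the algebra C^oo(M). *)
Record tangent_vector (p : M) (v : C -> R) : Prop := TangentVector {
  tangent_linear : forall (a : R) (f g : C), v (a *: f + g) = a * v f + v g;
  tangent_leibniz : forall f g : C, v (f * g) = f p * v g + g p * v f }.

Definition is_vector_field (X : M -> C -> R) : Prop :=
  (forall p, tangent_vector p (X p)) /\
  (forall f : C, is_smooth (fun p => X p f)).

Definition vector_field_pred : {pred M -> C -> R} :=
  fun X => `[< is_vector_field X >].

Fact vector_field_zmod : GRing.zmod_closed vector_field_pred.
Proof.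
split=> [|X Y /asboolP[tX sX] /asboolP[tY sY]]; apply/asboolP.
  split=> [p|f]; last exact/asboolP/(smooth_cst M 0).
  by split=> *; rewrite /= ?mulr0 ?addr0.
split=> [p|f].
  have [lX dX] := tX p; have [lY dY] := tY p.
  split=> [a f g|f g]; rewrite !fctE.
    by rewrite lX lY mulrBr opprD addrACA.
  by rewrite dX dY !mulrBr opprD addrACA.
have sXf : (fun p => X p f) \in smooth M by exact/asboolP.
have sYf : (fun p => Y p f) \in smooth M by exact/asboolP.
exact/asboolP/(rpredB sXf sYf).
Qed.

HB.instance Definition _ :=
  GRing.isZmodClosed.Build _ vector_field_pred vector_field_zmod.

Record vector_field := VectorField {
  field_val :> M -> C -> R;
  field_valP : field_val \in vector_field_pred }.

HB.instance Definition _ := [isSub for field_val].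
HB.instance Definition _ := [Choice of vector_field by <:].
HB.instance Definition _ :=
  [SubChoice_isSubZmodule of vector_field by <:].

Implicit Types (X Y : vector_field) (f g : C).

Fact field_scale_subproof f X :
  (fun p h => f p * X p h) \in vector_field_pred.
Proof.
have /asboolP[tX sX] := field_valP X; apply/asboolP; split=> [p|h].
  have [lX dX] := tX p; split=> [a h k|h k].
    by rewrite lX mulrDr mulrCA.
  by rewrite dX mulrDr mulrCA [X in _ + X]mulrCA.
have sXh : (fun p => X p h) \in smooth M by exact/asboolP.
exact/asboolP/(rpredM (smooth_valP f) sXh).
Qed.

Definition field_scale f X : vector_field :=
  VectorField (field_scale_subproof f X).

Lemma field_eqP X Y : (forall p h, X p h = Y p h) -> X = Y.
Proof. by move=> XY; apply/val_inj/funext => p; apply/funext => h; exact: XY. Qed.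

Fact field_scaleA f g X :
  field_scale f (field_scale g X) = field_scale (f * g) X.
Proof. by apply: field_eqP => p h; rewrite /= mulrA. Qed.

Fact field_scale1 : left_id 1 field_scale.
Proof. by move=> X; apply: field_eqP => p h; rewrite /= mul1r. Qed.

Fact field_scaleDr : right_distributive field_scale +%R.
Proof. by move=> f X Y; apply: field_eqP => p h; rewrite /= mulrDr. Qed.

Fact field_scaleDl X : {morph field_scale^~ X : f g / f + g}.
Proof. by move=> f g; apply: field_eqP => p h; rewrite /= mulrDl. Qed.

HB.instance Definition _ := GRing.Zmodule_isLmodule.Build C vector_field
  field_scaleA field_scale1 field_scaleDr field_scaleDl.

Fact derive_along_subproof X f : (fun p => X p f) \in smooth M.
Proof. by have /asboolP[_ sX] := field_valP X; exact/asboolP. Qed.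

Definition derive_along X f : C := SmoothFun (derive_along_subproof X f).

Lemma derive_alongP X a f g :
  derive_along X (a *: f + g) = a *: derive_along X f + derive_along X g.
Proof.
have /asboolP[tX _] := field_valP X.
by apply/val_inj/funext => p; have [lX _] := tX p; exact: lX.
Qed.

Lemma derive_alongM X f g :
  derive_along X (f * g) = f * derive_along X g + g * derive_along X f.
Proof.
have /asboolP[tX _] := field_valP X.
by apply/val_inj/funext => p; have [_ dX] := tX p; exact: dX.
Qed.

Fact bracket_subproof X Y :
  (fun p h => X p (derive_along Y h) - Y p (derive_along X h))
    \in vector_field_pred.
Proof.
have /asboolP[tX _] := field_valP X; have /asboolP[tY _] := field_valP Y.
have addE p (Z : C -> R) : tangent_vector p Z ->
    forall h k, Z (h + k) = Z h + Z k.
  by move=> [lZ _] h k; rewrite -[h]scale1r lZ mul1r scale1r.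
apply/asboolP; split=> [p|h]; last first.
  apply/asboolP; exact: (rpredB (derive_along_subproof X (derive_along Y h))
                                (derive_along_subproof Y (derive_along X h))).
have [[lX dX] [lY dY]] := (tX p, tY p).
split=> [a h k|h k].
  by rewrite !derive_alongP lX lY mulrBr opprD addrACA.
rewrite !derive_alongM (addE _ _ (tX p)) (addE _ _ (tY p)) !dX !dY /=.
ring.
Qed.

Definition bracket X Y : vector_field := VectorField (bracket_subproof X Y).

End VectorFields.

(* Tensor fields on M, as C^oo(M)-multilinear maps on vector fields. *)
Notation one_form M := {linear vector_field M -> smooth_fun M | *%R}.
Notation tensor11 M := {linear vector_field M -> vector_field M}.

Record tensor02 (R : realType) (n : nat) (M : manifold R n) := Tensor02 {
  tensor02_val :> vector_field M -> vector_field M -> smooth_fun M;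
  tensor02_linearl : forall Y,
    GRing.linear_for ( *%R : smooth_fun M -> _) (tensor02_val ^~ Y);
  tensor02_linearr : forall X,
    GRing.linear_for ( *%R : smooth_fun M -> _) (tensor02_val X) }.

Section Structures.
Variables (R : realType) (n : nat) (M : manifold R n).
Local Notation C := (smooth_fun M).
Local Notation VF := (vector_field M).
Implicit Types (eta : one_form M) (phi : tensor11 M) (xi : VF) (g : tensor02 M).

Definition ext_d eta (X Y : VF) : C :=
  (2^-1 : R) *: (derive_along X (eta Y) - derive_along Y (eta X)
                 - eta (bracket X Y)).

Definition nijenhuis phi (X Y : VF) : VF :=
  phi (phi (bracket X Y)) + bracket (phi X) (phi Y)
  - phi (bracket (phi X) Y) - phi (bracket X (phi Y)).

Definition almost_paracontact phi xi eta : Prop :=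
  (forall X, phi (phi X) = X - eta X *: xi) /\ eta xi = 1.

Definition almost_contact phi xi eta : Prop :=
  (forall X, phi (phi X) = - X + eta X *: xi) /\ eta xi = 1.

Definition paracontact_normal phi xi eta : Prop :=
  forall X Y, nijenhuis phi X Y = (2%:R * ext_d eta X Y) *: xi.

Definition contact_normal phi xi eta : Prop :=
  forall X Y, nijenhuis phi X Y = - (2%:R * ext_d eta X Y) *: xi.

(* Nondegeneracy is pointwise: g(X,Y)(p) depends only on X_p and Y_p. *)
Definition metric_tensor g : Prop :=
  (forall X Y, g X Y = g Y X) /\
  (forall (p : M) (X : VF), (forall Y : VF, g X Y p = 0) -> X p = 0).

(* The index set {1,2,3} of a mixed 3-structure, with its cyclic successor:
   the cyclic permutations of (1,2,3) are the (a, cyc a, cyc (cyc a)). *)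
Variant index3 := I1 | I2 | I3.

Definition cyc (a : index3) : index3 :=
  match a with I1 => I2 | I2 => I3 | I3 => I1 end.

Definition tau (a : index3) : C := if a is I3 then 1 else -1.

Section Mixed.
Variables (phi : index3 -> tensor11 M) (xi : index3 -> VF)
  (eta : index3 -> one_form M) (g : tensor02 M).

Definition almost_structure (a : index3) : Prop :=
  if a is I3 then almost_contact (phi a) (xi a) (eta a)
  else almost_paracontact (phi a) (xi a) (eta a).

Definition normal_structure (a : index3) : Prop :=
  if a is I3 then contact_normal (phi a) (xi a) (eta a)
  else paracontact_normal (phi a) (xi a) (eta a).

Definition mixed_relations (a b c : index3) : Prop :=
  [/\ (forall X,
         phi a (phi b X) - tau a *: (eta b X *: xi a) = tau c *: phi c X /\
         tau c *: phi c X = - phi b (phi a X) + tau b *: (eta a X *: xi b)),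
      (forall X,
         eta a (phi b X) = tau c * eta c X /\
         tau c * eta c X = - eta b (phi a X)),
      phi a (xi b) = tau b *: xi c
    & phi b (xi a) = - tau a *: xi c].

Definition mixed_3_structure : Prop :=
  (forall a, almost_structure a) /\
  (forall a, mixed_relations a (cyc a) (cyc (cyc a))).

Definition eps (a : index3) : C := g (xi a) (xi a).

Definition mixed_metric_3_structure : Prop :=
  [/\ mixed_3_structure,
      metric_tensor g,
      (forall a, eps a = 1 \/ eps a = -1)
    & forall a X Y,
        g (phi a X) (phi a Y) = tau a * (g X Y - eps a * eta a X * eta a Y)].

Definition fundamental_form (a : index3) (X Y : VF) : C := g X (phi a Y).

Definition mixed_metric_3_contact : Prop :=
  mixed_metric_3_structure /\
  (forall a X Y, ext_d (eta a) X Y = fundamental_form a X Y).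

Definition mixed_3_sasakian : Prop :=
  mixed_metric_3_structure /\
  (forall a, (forall X Y, ext_d (eta a) X Y = fundamental_form a X Y) /\
             normal_structure a).

End Mixed.
End Structures.

(* Main.v *)
Require Import Defs.
From HB Require Import structures.
From mathcomp Require Import all_boot all_order all_algebra.
From mathcomp Require Import all_classical all_reals all_analysis.
From mathcomp Require Import ring.

(** A metric 3-contact structure is normal for the same reason that an almost
    hyper-Hermitian structure with three closed fundamental forms is integrable
    (Hitchin's lemma); no connection is involved.

    Fix a cyclic permutation (a,b,c) of (1,2,3) and put
    S(X,Y) = N_a(X,Y) + 2 tau_a deta^a(X,Y) xi_a, so that normality of the
    a-th structure is the equation S = 0.  Two ideas make S vanish.

    - Up to sign and terms in the eta's, inserting phi_a in either slot exchanges the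
      2-forms Phi_b and Phi_c, because
      Phi_b(phi_a U, Z) = g(phi_a U, phi_b Z) = - g(U, phi_a phi_b Z)
      and phi_a phi_b is tau_c phi_c up to a rank one term; likewise composing
      with phi_a exchanges eta^b and eta^c.  Hence eta^b(N_a(X,Y)) and
      Phi_b(N_a(X,Y), Z), which contain brackets composed with phi_a, become
      expressions in eta^b, eta^c, Phi_b, Phi_c evaluated at plain brackets.

    - Each eta^i of a bracket is computed by deta^i = Phi_i, and each
      Phi_i([U,V], Z) by dPhi_i = 0.  After both substitutions everything
      cancels: eta^b(S) = 0 ([eta_cyc_normality]) and Phi_b(S, Z) = 0 for all Z
      ([fundamental_cyc_normality]).

    The second equation and nondegeneracy of g give phi_b(S) = 0; applying
    phi_b once more and using eta^b(S) = 0 gives S = 0. *)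

Set Implicit Arguments.
Unset Strict Implicit.
Unset Printing Implicit Defensive.

Import GRing.Theory.
Local Open Scope ring_scope.

(** * Derivations, brackets and exterior derivatives *)

Section Calculus.
Variables (R : realType) (n : nat) (M : manifold R n).
Local Notation C := (smooth_fun M).
Local Notation VF := (vector_field M).
Local Notation D := derive_along.
Implicit Types (X Y Z : VF) (f h : C) (eta : one_form M) (g : tensor02 M).

Lemma derive_alongD X f h : D X (f + h) = D X f + D X h.
Proof. by rewrite -[f]scale1r derive_alongP !scale1r. Qed.

Lemma derive_along0 X : D X 0 = 0.
Proof. by apply: (addrI (D X 0)); rewrite -derive_alongD !addr0. Qed.

Lemma derive_alongZ X (r : R) f : D X (r *: f) = r *: D X f.
Proof. by rewrite -[r *: f]addr0 derive_alongP derive_along0 addr0. Qed.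

Lemma derive_alongN X f : D X (- f) = - D X f.
Proof. by rewrite -scaleN1r derive_alongZ scaleN1r. Qed.

Lemma derive_alongB X f h : D X (f - h) = D X f - D X h.
Proof. by rewrite derive_alongD derive_alongN. Qed.

Lemma derive_along1 X : D X 1 = 0.
Proof.
by apply: (addrI (D X 1)); rewrite addr0 -[in RHS](mulr1 1) derive_alongM !mul1r.
Qed.

Lemma derive_along_bracket X Y f :
  D (bracket X Y) f = D X (D Y f) - D Y (D X f).
Proof. by apply/val_inj. Qed.

Lemma bracketC X Y : bracket X Y = - bracket Y X.
Proof. by apply: field_eqP => p h /=; rewrite opprB. Qed.

Lemma bracketxx X : bracket X X = 0.
Proof. by apply: field_eqP => p h /=; rewrite subrr. Qed.

Lemma bracket_jacobi X Y Z :
  bracket (bracket X Y) Z - bracket (bracket X Z) Y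
    + bracket (bracket Y Z) X = 0.
Proof.
apply: field_eqP => p h.
suff /(congr1 (fun k : C => k p)) :
    D (bracket (bracket X Y) Z) h - D (bracket (bracket X Z) Y) h
      + D (bracket (bracket Y Z) X) h = 0 by [].
rewrite !derive_along_bracket !derive_alongB; ring.
Qed.

Lemma mul2_half f : 2%:R * (2^-1 *: f) = f.
Proof.
apply/val_inj/funext => p; rewrite mulr_natl -scaler_nat scalerA.
by rewrite mulfV ?scale1r// pnatr_eq0.
Qed.

Lemma one_form_bracket eta X Y :
  eta (bracket X Y) = D X (eta Y) - D Y (eta X) - 2%:R * ext_d eta X Y.
Proof. rewrite /ext_d mul2_half; ring. Qed.

Lemma ext_dC eta X Y : ext_d eta X Y = - ext_d eta Y X.
Proof. rewrite /ext_d bracketC linearN -scalerN; congr (_ *: _); ring. Qed.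

Lemma ext_dxx eta X : ext_d eta X X = 0.
Proof. by rewrite /ext_d bracketxx linear0 subrr subr0 scaler0. Qed.

(** The identity d(d eta) = 0, solved for one of its three bracket terms: this
    is the form in which closedness rewrites a bracket in the first slot. *)
Lemma ext_d_closed eta X Y Z :
  ext_d eta (bracket X Y) Z =
  D X (ext_d eta Y Z) - D Y (ext_d eta X Z) + D Z (ext_d eta X Y)
  - ext_d eta (bracket Y Z) X + ext_d eta (bracket X Z) Y.
Proof.
rewrite /ext_d !derive_alongZ -!(scalerBr, scalerDr); congr (_ *: _).
rewrite !derive_alongB !derive_along_bracket.
have := congr1 eta (bracket_jacobi X Y Z); rewrite linear0 linearD linearB.
by move=> /eqP; rewrite addr_eq0 subr_eq => /eqP ->; ring.
Qed.

Lemma tensor02Dl g X Y Z : g (X + Y) Z = g X Z + g Y Z.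
Proof. by rewrite -[X]scale1r (tensor02_linearl g Z) !mul1r scale1r. Qed.

Lemma tensor02_0l g Z : g 0 Z = 0.
Proof. by apply: (addrI (g 0 Z)); rewrite -tensor02Dl !addr0. Qed.

Lemma tensor02Zl g f X Z : g (f *: X) Z = f * g X Z.
Proof. by rewrite -[f *: X]addr0 (tensor02_linearl g Z) tensor02_0l addr0. Qed.

Lemma tensor02Nl g X Z : g (- X) Z = - g X Z.
Proof. by rewrite -scaleN1r tensor02Zl mulN1r. Qed.

Lemma metric_nondegenerate g X :
  metric_tensor g -> (forall Y, g X Y = 0) -> X = 0.
Proof.
move=> [_ ndg] gX; apply: field_eqP => p h; rewrite (ndg p X)// => Y.
by rewrite gX.
Qed.

End Calculus.

Section Normality.
Variables (R : realType) (n : nat) (M : manifold R n).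
Variables (phi : index3 -> tensor11 M) (xi : index3 -> vector_field M)
  (eta : index3 -> one_form M) (g : tensor02 M).
Hypothesis contact : mixed_metric_3_contact phi xi eta g.
Local Notation VF := (vector_field M).
Local Notation D := derive_along.
Local Notation tau := (@tau R n M).
Local Notation eps := (eps xi g).
Local Notation Phi := (fundamental_form phi g).
Local Notation cyc2 a := (cyc (cyc a)).
Implicit Types (X Y Z U : VF) (a : index3).

(** * The three structures taken separately *)

Lemma tau_sqr a : tau a * tau a = 1.
Proof. by case: a => /=; rewrite ?mulrNN mulr1. Qed.

Lemma derive_along_tau X a : D X (tau a) = 0.
Proof. by case: a => /=; rewrite ?derive_alongN derive_along1 ?oppr0. Qed.

Lemma cyc3 a : cyc (cyc2 a) = a.
Proof. by case: a. Qed.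

Lemma metricC X Y : g X Y = g Y X.
Proof. by case: contact => -[_ [gC _] _ _] _. Qed.

Lemma metric_phi a X Y :
  g (phi a X) (phi a Y) = tau a * (g X Y - eps a * eta a X * eta a Y).
Proof. by case: contact => -[_ _ _ ->] _. Qed.

Lemma ext_d_eta a X Y : ext_d (eta a) X Y = Phi a X Y.
Proof. by case: contact => _ ->. Qed.

Lemma eps_sqr a : eps a * eps a = 1.
Proof.
by case: contact => -[_ _ /(_ a) + _] _ => -[] ->; rewrite ?mulrNN mulr1.
Qed.

Lemma derive_along_eps X a : D X (eps a) = 0.
Proof.
by case: contact => -[_ _ /(_ a) + _] _ => -[] ->;
  rewrite ?derive_alongN derive_along1 ?oppr0.
Qed.

Lemma eta_xi a : eta a (xi a) = 1.
Proof. by case: contact => -[[/(_ a) as_ _] _ _ _] _; case: a as_ => -[]. Qed.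

(** The sign tau_a is what makes the paracontact and the contact axiom the same
    equation. *)
Lemma phi_sqr a X : phi a (phi a X) = - (tau a *: (X - eta a X *: xi a)).
Proof.
case: contact => -[[/(_ a) as_ _] _ _ _] _; case: a as_ => -[-> _] /=.
- by rewrite scaleN1r opprK.
- by rewrite scaleN1r opprK.
- by rewrite scale1r opprB addrC.
Qed.

(** Antisymmetry comes for free from Phi_a being an exterior derivative. *)
Lemma fundamentalC a X Y : Phi a X Y = - Phi a Y X.
Proof. by rewrite -!ext_d_eta ext_dC. Qed.

Lemma metric_phil a X Y : g (phi a X) Y = - Phi a X Y.
Proof. by rewrite metricC [g Y _](fundamentalC a Y X). Qed.

Lemma fundamental_phiC a X Y : Phi a X (phi a Y) = - Phi a (phi a X) Y.
Proof. by rewrite fundamentalC /fundamental_form metricC. Qed.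

(** Computing the cube of phi_a in two ways shows phi_a(xi_a) to be a multiple
    k xi_a; then k eps_a = Phi_a(xi_a, xi_a) = 0. *)
Lemma phi_xi a : phi a (xi a) = 0.
Proof.
pose k := eta a (phi a (xi a)).
have phiE : phi a (xi a) = k *: xi a.
  have := congr1 (phi a) (phi_sqr a (xi a)).
  rewrite eta_xi scale1r subrr scaler0 oppr0 linear0 phi_sqr => /eqP.
  rewrite oppr_eq0 => /eqP /(congr1 (fun V => tau a *: V)).
  by rewrite scalerA tau_sqr scale1r scaler0 => /eqP; rewrite subr_eq0 => /eqP.
have : Phi a (xi a) (xi a) = 0 by rewrite -ext_d_eta ext_dxx.
rewrite /fundamental_form phiE metricC tensor02Zl.
move=> /(congr1 ( *%R^~ (eps a))).
by rewrite -mulrA eps_sqr mulr1 mul0r => ->; rewrite scale0r.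
Qed.

Lemma metric_xi a X : g (xi a) X = eps a * eta a X.
Proof.
have := metric_phi a (xi a) X.
rewrite phi_xi tensor02_0l eta_xi mulr1 => /(congr1 ( *%R (tau a))).
by rewrite mulr0 mulrA tau_sqr mul1r => /esym/eqP; rewrite subr_eq0 => /eqP.
Qed.

Lemma eta_phi a X : eta a (phi a X) = 0.
Proof.
have : g (xi a) (phi a X) = 0.
  rewrite -[LHS]/(Phi a (xi a) X) fundamentalC /fundamental_form phi_xi.
  by rewrite metricC tensor02_0l oppr0.
rewrite metric_xi => /(congr1 ( *%R (eps a))).
by rewrite mulr0 mulrA eps_sqr mul1r.
Qed.

Lemma eta_bracket a X Y :
  eta a (bracket X Y) = D X (eta a Y) - D Y (eta a X) - 2%:R * Phi a X Y.
Proof. by rewrite one_form_bracket ext_d_eta. Qed.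

Lemma fundamental_closed a X Y Z :
  Phi a (bracket X Y) Z =
  D X (Phi a Y Z) - D Y (Phi a X Z) + D Z (Phi a X Y)
  - Phi a (bracket Y Z) X + Phi a (bracket X Z) Y.
Proof. by rewrite -!ext_d_eta ext_d_closed. Qed.

(** * How one structure exchanges the forms of the other two *)

Lemma phi_phi_cyc a X : phi a (phi (cyc a) X) =
  tau (cyc2 a) *: phi (cyc2 a) X + tau a *: (eta (cyc a) X *: xi a).
Proof.
case: contact => -[[_ /(_ a)[/(_ X)[rel _] _ _ _]] _ _ _] _.
by apply/eqP; rewrite -subr_eq rel.
Qed.

Lemma phi_cyc_phi a X : phi (cyc a) (phi a X) =
  tau (cyc a) *: (eta a X *: xi (cyc a)) - tau (cyc2 a) *: phi (cyc2 a) X.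
Proof.
case: contact => -[[_ /(_ a)[/(_ X)[_ rel] _ _ _]] _ _ _] _.
by rewrite rel opprD opprK addrCA subrr addr0.
Qed.

Lemma eta_phi_cyc a X :
  eta a (phi (cyc a) X) = tau (cyc2 a) * eta (cyc2 a) X.
Proof. by case: contact => -[[_ /(_ a)[_ /(_ X)[-> _] _ _]] _ _ _] _. Qed.

Lemma eta_cyc_phi a X :
  eta (cyc a) (phi a X) = - (tau (cyc2 a) * eta (cyc2 a) X).
Proof.
by case: contact => -[[_ /(_ a)[_ /(_ X)[_ ->] _ _]] _ _ _] _; rewrite opprK.
Qed.

Lemma eta_cyc2_phi a X : eta (cyc2 a) (phi a X) = tau (cyc a) * eta (cyc a) X.
Proof. by have := eta_phi_cyc (cyc2 a) X; rewrite !cyc3. Qed.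

Lemma eta_cyc_xi a : eta (cyc a) (xi a) = 0.
Proof.
have phiE : phi (cyc a) (xi (cyc2 a)) = tau (cyc2 a) *: xi a.
  by case: contact => -[[_ /(_ (cyc a))[_ _ -> _]] _ _ _] _; rewrite cyc3.
have := eta_phi (cyc a) (xi (cyc2 a)).
rewrite phiE linearZ_LR => /(congr1 ( *%R (tau (cyc2 a)))).
by rewrite mulr0 /= mulrA tau_sqr mul1r.
Qed.

(** The 2-form Phi_b is of pure type with respect to phi_a, relative to Phi_c
    and up to eta terms.  This and the next lemma replace the statement that
    one (para)complex combination of Phi_b and Phi_c is a form of type (2,0). *)
Lemma fundamental_cyc_phil a U Z : Phi (cyc a) (phi a U) Z =
  - (tau a * eps a * eta a U * eta (cyc a) Z
     + tau (cyc2 a) * Phi (cyc2 a) U Z).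
Proof.
rewrite {1}/fundamental_form metric_phil {1}/fundamental_form phi_phi_cyc.
rewrite metricC tensor02Dl !tensor02Zl metric_xi metricC.
by congr (- _); rewrite /fundamental_form; ring.
Qed.

Lemma fundamental_cyc2_phil a U Z : Phi (cyc2 a) (phi a U) Z =
  - (tau a * eps a * eta a U * eta (cyc2 a) Z) + tau (cyc a) * Phi (cyc a) U Z.
Proof.
rewrite {1}/fundamental_form metric_phil {1}/fundamental_form.
have := phi_cyc_phi (cyc2 a) Z; rewrite !cyc3 => ->.
rewrite metricC tensor02Dl tensor02Nl !tensor02Zl metric_xi metricC.
by rewrite /fundamental_form; ring.
Qed.

Lemma fundamental_cyc_phir a U Z : Phi (cyc a) U (phi a Z) =
  tau a * eps a * eta a Z * eta (cyc a) U - tau (cyc2 a) * Phi (cyc2 a) U Z.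
Proof.
by rewrite fundamentalC fundamental_cyc_phil [Phi _ Z U]fundamentalC; ring.
Qed.

Lemma fundamental_cyc2_phir a U Z : Phi (cyc2 a) U (phi a Z) =
  tau a * eps a * eta a Z * eta (cyc2 a) U + tau (cyc a) * Phi (cyc a) U Z.
Proof.
by rewrite fundamentalC fundamental_cyc2_phil [Phi _ Z U]fundamentalC; ring.
Qed.

(** * Vanishing of the normality tensor *)

Definition normality_tensor a X Y : VF :=
  nijenhuis (phi a) X Y + (2%:R * tau a * ext_d (eta a) X Y) *: xi a.

(** Expanding eta^b and eta^c of brackets leaves derivatives of eta^b and eta^c
    on X and Y, which cancel because tau_b tau_c = tau_a, and values of Phi_b
    and Phi_c, which cancel by the exchange rules. *)
Lemma eta_cyc_normality a X Y : eta (cyc a) (normality_tensor a X Y) = 0.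
Proof.
rewrite /normality_tensor /nijenhuis linearD linearZ_LR /= eta_cyc_xi mulr0.
rewrite addr0 !linearB !linearD /=.
rewrite !(eta_cyc_phi, eta_cyc2_phi) !eta_bracket.
rewrite !(fundamental_cyc_phir, fundamental_cyc2_phir,
  fundamental_cyc_phil, fundamental_cyc2_phil).
rewrite !(eta_phi, eta_cyc_phi, eta_cyc2_phi).
rewrite !(derive_alongN, derive_alongM, derive_along_tau).
(* the three values of a turn the relations between the signs tau into
   numerical identities *)
by case: a => /=; ring.
Qed.

(** Closedness of Phi_b and Phi_c moves each bracket of X and Y onto a bracket
    with Z.  The remaining brackets come in pairs, such as
    Phi_b([phi_a Y, Z], phi_a X) and Phi_c([phi_a Y, Z], X), which the exchange
    rules cancel up to eta terms; deta = Phi then removes the brackets from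
    those. *)
Lemma fundamental_cyc_normality a X Y Z :
  Phi (cyc a) (normality_tensor a X Y) Z = 0.
Proof.
rewrite /normality_tensor /nijenhuis /fundamental_form.
rewrite !tensor02Dl !tensor02Nl tensor02Zl phi_sqr tensor02Nl tensor02Zl.
rewrite tensor02Dl tensor02Nl tensor02Zl metric_xi eta_phi_cyc.
rewrite ext_d_eta -!/(Phi _ _ _) !fundamental_cyc_phil.
(* closedness is applied to the four brackets of N_a by hand, since rewriting
   with it exhaustively would not terminate *)
rewrite (fundamental_closed _ (phi a X) (phi a Y)).
rewrite (fundamental_closed _ (phi a X) Y) (fundamental_closed _ X (phi a Y)).
rewrite (fundamental_closed _ X Y) !eta_bracket.
rewrite !(fundamental_cyc_phir, fundamental_cyc2_phir,
  fundamental_cyc_phil, fundamental_cyc2_phil).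
rewrite !(eta_phi, eta_cyc_phi, eta_cyc2_phi, eta_bracket, fundamental_phiC).
rewrite !(fundamental_cyc_phil, fundamental_cyc2_phil).
rewrite !(derive_alongN, derive_alongD, derive_alongM, derive_along_tau,
  derive_along_eps, derive_along0).
by case: a => /=; ring.
Qed.

Lemma normality_tensor_eq0 a X Y : normality_tensor a X Y = 0.
Proof.
have phiS : phi (cyc a) (normality_tensor a X Y) = 0.
  apply: (@metric_nondegenerate _ _ _ g); first by case: contact => -[].
  by move=> Z; rewrite metric_phil fundamental_cyc_normality oppr0.
have := phi_sqr (cyc a) (normality_tensor a X Y).
rewrite phiS linear0 eta_cyc_normality scale0r subr0 => /esym/eqP.
rewrite oppr_eq0 => /eqP/(congr1 (fun V => tau (cyc a) *: V)).
by rewrite scalerA tau_sqr scale1r scaler0.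
Qed.

Lemma contact_normal_structure a : normal_structure phi xi eta a.
Proof.
have NE X Y :
    nijenhuis (phi a) X Y = - ((2%:R * tau a * ext_d (eta a) X Y) *: xi a).
  by apply/eqP; rewrite -addr_eq0; apply/eqP; exact: normality_tensor_eq0.
case: a NE => NE X Y; rewrite NE -scaleNr /=; congr (_ *: _); ring.
Qed.

End Normality.

Theorem theorem5p7 (R : realType) (n : nat) (M : manifold R n)
  (phi : index3 -> tensor11 M) (xi : index3 -> vector_field M)
  (eta : index3 -> one_form M) (g : tensor02 M) :
  mixed_metric_3_contact phi xi eta g ->
  mixed_3_sasakian phi xi eta g.
Proof.
move=> contact; have [metric_structure ext_dE] := contact.
split=> // a; split; first exact: ext_dE.
exact: contact_normal_structure contact a.
Qed.
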